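(* Let $(F_n)_{n\ge 0}$ be the Fibonacci sequence, $F_0=0$, $F_1=1$, $F_n=F_{n-1}+F_{n-2}$ for $n\ge 2$. Fix a positive integer $N$. Consider a walk $a_1,a_2,\dots$ of positive Fibonacci numbers such that for each pair of consecutive terms there are integers $n_i$ and $d_i$ with $1\le n_i\le N$, $0\le d_i\le 10^{n_i}-1$ and $a_{i+1}=10^{n_i}a_i+d_i$ (i.e., each term is obtained from the previous by appending at most $N$ decimal digits to the right, leading zeros in the appended block allowed). Suppose the starting number $a_1$ has $N_0$ decimal digits. If $N_0\ge 2$, then the length of the walk (number of terms, including $a_1$) is at most $\left\lfloor \log_2\frac{N}{N_0-1}\right\rfloor+2$. If $N_0=1$, the length of the walk is at most $\lfloor \log_2 N\rfloor+2$.
   Context: Appending $n$ digits to a positive integer $a$ means forming $10^n a+d$ with $0\le d\le 10^n-1$; the appended block may have leading zeros.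
   Formalization: For N_0 ≥ 2, a walk consisting of a_1 alone is covered only when N_0 − 1 ≤ 2N; otherwise the stated bound is at most 0 and fails (e.g. N = 1, a_1 = 1597: the bound is 0, the length is 1). Walks with at least two terms are covered as stated. *)

(* Defs.v *)
From mathcomp Require Import all_boot all_order all_algebra.
From mathcomp Require Import reals exp.

Set Implicit Arguments.
Unset Strict Implicit.
Unset Printing Implicit Defensive.

Fixpoint fib (n : nat) : nat :=
  match n with
  | 0 => 0
  | 1 => 1
  | (m.+1 as p).+1 => fib p + fib m
  end.

Definition pos_fibonacci (a : nat) : Prop := 0 < a /\ exists k, a = fib k.

Definition append_step (N a b : nat) : Prop :=
  exists n d : nat,
    [/\ 1 <= n <= N, 0 <= d <= 10 ^ n - 1 & b = 10 ^ n * a + d].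

(* The first L terms a 0, ..., a L.-1 of a form a walk; the values a i with
   L <= i are irrelevant.  An infinite walk is a sequence a with
   fib_walk N a L for every L, so a bound on L also rules those out. *)
Definition fib_walk (N : nat) (a : nat -> nat) (L : nat) : Prop :=
  (forall i, i < L -> pos_fibonacci (a i)) /\
  (forall i, i.+1 < L -> append_step N (a i) (a i.+1)).

(* trunc_log 10 a is the largest e with 10 ^ e <= a; meant for a > 0. *)
Definition num_digits (a : nat) : nat := (trunc_log 10 a).+1.

Definition log2 (R : realType) (x : R) : R := (ln x / ln 2)%R.

(* Main.v *)
Require Import Defs.
From mathcomp Require Import all_boot all_order all_algebra.
From mathcomp Require Import reals exp.
From mathcomp Require Import zify lra.

(** Let [L_j] be the Lucas numbers.  Suppose [F_(k+j) = 10^n F_k + d] with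
    [0 <= d < 10^n] and [10^n <= F_k].  Then [j < k], and the identity
    [F_(k+j) = L_j F_k - (-1)^j F_(k-j)] gives
    [d = (L_j - 10^n) F_k - (-1)^j F_(k-j)], where [0 <= d < F_k] and
    [0 < F_(k-j) < F_k].  Hence [L_j] is [10^n], or [10^n + 1] with [j] even.
    Both are impossible modulo 5, where the Lucas numbers are
    2, 1, 3, 4, 2, 1, ...  So [F_k < 10^n]: every step appends at least as many
    digits as there were, the number of digits at least doubles, and the last
    step gives [2^(L-2) N0 <= N]. *)

Lemma fibSS n : fib n.+2 = fib n.+1 + fib n.
Proof. by []. Qed.

Lemma fib_gt0 n : 0 < fib n.+1.
Proof. by elim: n => // n IHn; rewrite fibSS; lia. Qed.

Lemma leq_fib m n : m <= n -> fib m <= fib n.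
Proof.
move=> /subnK <-; elim: (n - m) => // i IHi.
by rewrite addSn; apply: leq_trans IHi _; case: (i + m) => // p; rewrite fibSS leq_addr.
Qed.

Lemma ltn_fib m n : m < n -> 2 < n -> fib m < fib n.
Proof.
case: n => [|[|[|n]]] // lt_mn _.
have := leq_fib _ _ (lt_mn : m <= n.+2).
by rewrite (fibSS n.+1); have := fib_gt0 n; lia.
Qed.

Lemma fib_addS m n : fib (m + n).+1 = fib m.+1 * fib n.+1 + fib m * fib n.
Proof.
elim: m n => [|m IHm] n; first by rewrite add0n mul1n mul0n addn0.
by rewrite addSnnS IHm !fibSS; lia.
Qed.

Fixpoint lucas (n : nat) : nat :=
  match n with
  | 0 => 2
  | 1 => 1
  | (m.+1 as p).+1 => lucas p + lucas m
  end.

Lemma lucasSS n : lucas n.+2 = lucas n.+1 + lucas n.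
Proof. by []. Qed.

(** This is the identity for [F_(k+j)] with [k = r + j], split by the parity of [j] so that no
    natural subtraction occurs. *)
Lemma fib_lucas j r :
  if odd j then fib (r + j + j) = lucas j * fib (r + j) + fib r
  else fib (r + j + j) + fib r = lucas j * fib (r + j).
Proof.
elim/ltn_ind: j r => -[_ r|[_ r|j IHj r]].
- by rewrite /= !addn0; lia.
- by rewrite /= !addn1 fibSS; lia.
(* The shifts of [r] keep the middle index at [r + j.+2], so the two instances add up through the
   Lucas recurrence. *)
have := IHj j.+1 (ltnSn _) r.+1; have := IHj j (leqnSn _) r.+2.
have -> : r.+2 + j + j = (r + j + j).+2 by lia.
have -> : r.+1 + j.+1 + j.+1 = (r + j + j).+3 by lia.
have -> : r + j.+2 + j.+2 = (r + j + j).+4 by lia.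
have -> : r.+2 + j = r + j.+2 by lia.
have -> : r.+1 + j.+1 = r + j.+2 by lia.
rewrite lucasSS (fibSS r) (fibSS (_.+2)) /= negbK.
by case: (odd j) => /=; rewrite mulnDl; lia.
Qed.

(** Tracking the parity shows that residue 0 never occurs and that residue 1 occurs only at odd
    indices. *)
Lemma lucas_mod5 n :
  (lucas n %% 5, lucas n.+1 %% 5, odd n) \in
  [:: (2, 1, false); (1, 3, true); (3, 4, false); (4, 2, true)].
Proof.
elim: n => // n; rewrite lucasSS -modnDm oddS !inE.
by move=> /or4P[] /eqP[-> -> ->].
Qed.

Lemma fib_append_lt m k n d :
  0 < n -> d < 10 ^ n -> fib m = 10 ^ n * fib k + d -> fib k < 10 ^ n.
Proof.
move=> n_gt0 lt_d Em; rewrite ltnNge; apply/negP => le_k.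
have T_gt1 : 10 <= 10 ^ n by rewrite -{1}(expn1 10) leq_exp2l.
have T_mod : 10 ^ n %% 5 = 0.
  by rewrite -(prednK n_gt0) expnS -modnMml mul0n mod0n.
move: (10 ^ n) lt_d le_k Em T_gt1 T_mod => T lt_d le_k Em T_gt1 T_mod.
have lt_km : k < m.
  by rewrite ltnNge; apply/negP => /leq_fib; rewrite Em; nia.
have [j Ej] : exists j, m = k + j.+1 by exists (m - k).-1; lia.
have k_gt2 : 2 < k by case: k le_k {lt_km Ej Em} => [|[|[|k]]] //=; lia.
(* Otherwise [F_m >= F_k * F_(j+2) >= F_k * (T + 1) >= T * F_k + T], which exceeds [T * F_k + d]. *)
have lt_jk : j.+1 < k.
  rewrite ltnNge; apply/negP => le_kj.
  have : fib k * fib j.+2 <= fib m.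
    rewrite Ej addnS -{2}(prednK (ltnW (ltnW k_gt2))) addSnnS fib_addS.
    by rewrite prednK ?leq_addr //; lia.
  have := ltn_fib k j.+2 le_kj (leq_trans k_gt2 (leqW le_kj)).
  by nia.
have [r [Er r_gt0]] : exists r, k = r + j.+1 /\ 0 < r by exists (k - j.+1); lia.
have fr_gt0 : 0 < fib r by case: r r_gt0 {Er} => // r _; apply: fib_gt0.
have lt_fr : fib r < fib k by apply: ltn_fib => //; lia.
have := fib_lucas j.+1 r; rewrite -Er -Ej Em.
have := lucas_mod5 j.+1; rewrite !inE.
move: (lucas j.+1) (lucas j.+2) (odd j.+1) => l l' b lucas5.
case: b lucas5 => lucas5 El.
(* Here [(l - T) * F_k = d - F_r] lies strictly between [-F_k] and [F_k]. *)
- have El' : l = T by nia.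
  by move: lucas5; rewrite El' T_mod.
(* Here [(l - T) * F_k = d + F_r] is less than [2 * F_k]. *)
- have [El'|El'] : l = T \/ l = T + 1 by nia.
    by move: lucas5; rewrite El' T_mod.
  by move: lucas5; rewrite El' -modnDm T_mod !xpair_eqE !andbF.
Qed.

Lemma num_digits_append a n d :
  0 < a -> num_digits a + n <= num_digits (10 ^ n * a + d).
Proof.
move=> a_gt0; rewrite /num_digits addSn ltnS trunc_log_max //.
rewrite addnC expnD (leq_trans _ (leq_addr _ _)) // leq_mul2l.
by rewrite trunc_logP ?orbT.
Qed.

Lemma fib_append_step N a b :
  pos_fibonacci a -> pos_fibonacci b -> append_step N a b ->
  num_digits a <= N /\ 2 * num_digits a <= num_digits b.
Proof.
move=> [a_gt0 [k Ek]] [_ [m Em]] [n [d [/andP[n_gt0 le_nN] /andP[_ le_d] Eb]]].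
have T_gt0 : 0 < 10 ^ n by rewrite expn_gt0.
have lt_a : a < 10 ^ n.
  rewrite Ek; apply: (fib_append_lt m k n d n_gt0); first by lia.
  by rewrite -Em Eb Ek.
have le_an : num_digits a <= n.
  rewrite /num_digits -(ltn_exp2l _ _ (isT : 1 < 10)).
  exact: leq_ltn_trans (trunc_logP _ a_gt0) lt_a.
split; first exact: leq_trans le_nN.
by rewrite Eb mul2n -addnn (leq_trans _ (num_digits_append _ _ _ a_gt0)) ?leq_add2l.
Qed.

(** Doubling is followed up to the penultimate term [a L], whose digit count the last step bounds by
    [N]. *)
Lemma fib_walk_digits N a L :
  fib_walk N a L.+2 -> 2 ^ L * num_digits (a 0) <= N.
Proof.
move=> [fib_a step_a].
have step i : i.+1 < L.+2 ->
    num_digits (a i) <= N /\ 2 * num_digits (a i) <= num_digits (a i.+1).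
  by move=> lt_i; apply: fib_append_step (step_a _ lt_i); apply: fib_a => //; exact: ltnW.
suff digits i : i <= L -> 2 ^ i * num_digits (a 0) <= num_digits (a i).
  by apply: leq_trans (digits L (leqnn L)) _; have [] := step L (ltnSn _).
elim: i => [|i IHi] lt_i; first by rewrite mul1n.
have [_] := step i (leqW lt_i); apply: leq_trans.
by rewrite expnS -mulnA leq_mul2l IHi // ltnW.
Qed.

Import Order.TTheory GRing.Theory Num.Theory.

(** The factor 4 replaces the exponent [L - 2], which would truncate at [L = 1]. *)
Lemma le_floor_log2 (R : realType) (L M N : nat) :
  0 < M -> 0 < N -> 2 ^ L * M <= 4 * N ->
  (L%:Z <= Num.floor (log2 (N%:R / M%:R : R)) + 2)%R.
Proof.
move=> M_gt0 N_gt0 le_MN.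
have ln2_gt0 : (0 < ln (2 : R))%R by rewrite ln_gt0 // ltr1n.
have posM : (M%:R : R)%R \is Num.pos by rewrite posrE ltr0n.
have posN : (N%:R : R)%R \is Num.pos by rewrite posrE ltr0n.
have pos2 k : ((2 : R) ^+ k)%R \is Num.pos by rewrite posrE exprn_gt0.
rewrite -lerBlDr floor_ge_int /log2 ler_pdivlMr // intrB ln_div //.
have : (ln ((2 : R) ^+ L * M%:R) <= ln ((2 : R) ^+ 2 * N%:R))%R.
  rewrite ler_ln; [|exact: rpredM..].
  by rewrite -!natrX -!natrM ler_nat.
rewrite (lnM (pos2 L) posM) (lnM (pos2 2) posN) !lnXn // -[(ln 2 *+ L)%R]mulr_natl.
rewrite -[(ln 2 *+ 2)%R]mulr_natl (_ : L%:~R = L%:R)%R // (_ : 2%:~R = 2%:R)%R // mulrBl.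
by lra.
Qed.

Theorem theorem1p3 (R : realType) (N : nat) (hN : 0 < N)
    (a : nat -> nat) (L : nat) (hL : 0 < L) (hwalk : fib_walk N a L)
    (N0 : nat) (hN0 : N0 = num_digits (a 0)) :
  (* A one-term walk is only considered when N0 - 1 <= 2 N: otherwise the
     stated bound is at most 0. *)
  (2 <= N0 -> 2 <= L \/ N0 - 1 <= 2 * N ->
     (L%:Z <= Num.floor (log2 (N%:R / (N0 - 1)%:R : R)) + 2)%R) /\
  (N0 = 1 ->
     (L%:Z <= Num.floor (log2 (N%:R : R)) + 2)%R).
Proof.
(* [M] will be [N0 - 1] in the first claim and 1 in the second. *)
have bound M : M <= N0 -> 2 <= L \/ M <= 2 * N -> 2 ^ L * M <= 4 * N.
  move=> le_M; case: L hL hwalk => [//|[|L]] _ walk.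
    by case=> // ?; rewrite expn1; lia.
  move=> _; have := fib_walk_digits _ _ _ walk; rewrite -hN0.
  rewrite !expnS mulnA -mulnA leq_mul2l /=; apply: leq_trans.
  by rewrite leq_mul2l le_M orbT.
split=> [le2 hL2 | N01].
  by apply: le_floor_log2 => //; [lia | apply: bound => //; apply: leq_subr].
have := le_floor_log2 R L 1 N isT hN; rewrite divr1; apply.
by apply: bound; [rewrite N01 | right; lia].
Qed.
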